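(* Let $i \ge 1$ be an integer, $R \subseteq \mathbb{R}^i$, $s \in \mathbb{R}^{i}$, let $\mathtt{C} = (I_1, \ldots, I_k)$ be a sequence of symbolic intervals whose bounds are indexed root expressions with domain $\mathbb{R}^i$ (or $\pm\infty$), and let $\preceq$ be an indexed root ordering on a set $\Xi$ of indexed root expressions with domain $\mathbb{R}^i$. Write $\preceq^t$ for the reflexive and transitive closure of $\preceq$. Assume that $\mathtt{C}$ fulfils the following conditions: (1) $I_1.l=-\infty$ and $I_k.u=\infty$; (2) for $j = 1,\ldots,k-1$: $I_{j}.l(s) < I_{j+1}.l(s)$, or ($I_{j}.l(s) = I_{j+1}.l(s)$ and $I_{j}$ is a section and $I_{j+1}$ is a sector); (3) for $j = 1,\ldots,k-1$: $I_{j}.u(s) < I_{j+1}.u(s)$, or ($I_{j}.u(s) = I_{j+1}.u(s)$ and $I_{j}$ is a sector and $I_{j+1}$ is a section); (4) for $j = 1,\ldots,k-1$: $I_{j+1}.l(s) < I_j.u(s)$, or ($I_{j+1}.l(s) = I_j.u(s)$ and at least one of $I_{j+1}$, $I_j$ is a section). Assume that $\preceq$ matches $s$, and that $I_{j+1}.l \preceq^t I_j.u$ for $j = 1,\ldots,k-1$. Suppose that the following properties hold: (a) $s \in R$; (b) $R$ is connected; (c) $\preceq$ matches $s$ and $R$ maintains the ordering $\preceq$; (d) for every $j = 1,\ldots,k-1$, the defining polynomials $I_j.u.p$ and $I_{j+1}.l.p$ are each analytically delineable on some connected superset of $R$. Then the property $\mathit{cov}(\mathtt{C},s)$ holds on $R$;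 that is, for every $R' \subseteq \mathbb{R}^{i+1}$ whose projection onto the first $i$ coordinates equals $R$, there exists a $j \in \{1,\ldots,k\}$ such that the property $\mathit{repr}(I_j,s)$ holds on some superset of $R'$.
   Context: Indexed root expressions. For $p \in \mathbb{Q}[x_1,\ldots,x_{i+1}]$ and an integer $m \ge 1$, the indexed root expression $\mathrm{root}_{p,m}$ is the function $\mathbb{R}^i \to \mathbb{R} \cup \{\text{undefined}\}$ mapping $r$ to the $m$-th real root of the univariate polynomial $p(r,x_{i+1})$, or to ''undefined'' if that root does not exist. For $\xi=\mathrm{root}_{p,m}$, write $\xi.p$ for its defining polynomial $p$. Symbolic intervals. A symbolic interval (over $\mathbb{R}^i$) is either a section $(\text{section}, b)$, where $b$ is an indexed root expression with domain $\mathbb{R}^{i}$, or a sector $(\text{sector}, l, u)$, where $l$ is $-\infty$ or an indexed root expression with domain $\mathbb{R}^i$, and $u$ is $\infty$ or an indexed root expression with domain $\mathbb{R}^i$. For a sector $I$, $I.l$ and $I.u$ denote its bounds; for a section $I$, $I.l = I.u = b$. Over a set $S\subseteq\mathbb{R}^i$ on which the bounds are defined, a section describes the set $\{ (r,b(r)) \mid r \in S \}$ and a sector describes the set $\{ (r,r') \mid r \in S,\ l(r) < r' < u(r) \}$. Property repr. For $T\subseteq\mathbb{R}^{i+1}$, a symbolic interval $I$ over $\mathbb{R}^i$ and $s\in\mathbb{R}^i$, the property $\mathit{repr}(I,s)$ holds on $T$ iff $I$ is defined at $s$ and the $(i+1)$-th dimension of $T$ is described by $I$, i.e. $T$ is the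 set described by $I$ over the projection of $T$ onto the first $i$ coordinates. Indexed root orderings. An indexed root ordering is a relation $\preceq$ on a set $\Xi$ of indexed root expressions with domain $\mathbb{R}^i$ such that its reflexive and transitive closure $\preceq^t$ is a partial order on $\Xi$. It matches $s\in\mathbb{R}^i$ if all $\xi\in\Xi$ are defined at $s$ and $\xi \preceq \xi'$ implies $\xi(s) \leq \xi'(s)$ for all $\xi,\xi' \in \Xi$. The set $R$ maintains the ordering $\preceq$ if, for all $\xi\preceq\xi'$, the roots $\xi$ and $\xi'$ remain over all of $R$ in the same order as at $s$. Analytic delineability. A polynomial $p\in\mathbb{Q}[x_1,\ldots,x_{i+1}]$ is analytically delineable on a connected set $S\subseteq\mathbb{R}^i$ if $p(r,x_{i+1})$ is not the zero polynomial for any $r \in S$ and there are finitely many real-analytic functions $\theta_1<\cdots<\theta_m : S\to\mathbb{R}$ ($m\ge 0$) such that for every $r \in S$ the set of real roots of $p(r,x_{i+1})$ is exactly $\{\theta_1(r),\dots,\theta_m(r)\}$, and the multiplicity of each $\theta_j(r)$ as a root of $p(r,x_{i+1})$ does not depend on $r\in S$.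
   Formalization: The conclusion is corrected: instead of a single j with repr(I_j,s) on a superset of all of R' (false for k ≥ 2, e.g. R' = R × ℝ), there are sets T_1,…,T_k with repr(I_j,s) on each T_j whose union contains R'. *)

(* Defs.v *)
From Stdlib Require Relation_Definitions Relation_Operators.
From HB Require Import structures.
From mathcomp Require Import all_boot all_order all_algebra.
From mathcomp Require Import all_classical all_reals all_analysis.
From mathcomp Require polyrcf mpoly.
Import Order.TTheory GRing.Theory Num.Theory.
Import numFieldNormedType.Exports.

Set Implicit Arguments.
Unset Strict Implicit.
Unset Printing Implicit Defensive.

Local Open Scope classical_set_scope.
Local Open Scope ring_scope.

(* A point of R^(i+1) is a row vector x : 'rV_i.+1: its first i coordinates
   are [init_coords x], its last one is [x 0 ord_max]. *)
Definition init_coords (R : realType) (i : nat) (x : 'rV[R]_i.+1) : 'rV[R]_i :=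
  \row_(j < i) x 0 (lift ord_max j).

Definition ratpoly (i : nat) : Type := mpoly.mpoly i.+1 rat.

(* The univariate polynomial p(r, x_(i+1)); [unlift ord_max j] is [None]
   exactly when j is the index of the last variable. *)
Definition specialize (R : realType) (i : nat) (p : ratpoly i)
    (r : 'rV[R]_i) : {poly R} :=
  mpoly.mmap (fun c : rat => (ratr c : R)%:P)
    (fun j : 'I_i.+1 => if unlift ord_max j is Some j' then (r 0 j')%:P
                        else 'X)
    p.

(* root_{p,m}, kept as a syntactic object: several pairs (p, m) may denote the
   same function, and the defining polynomial p has to be recoverable. *)
Record iroot (i : nat) := IRoot {
  ir_poly : ratpoly i;
  ir_index : nat;
  ir_index_gt0 : (0 < ir_index)%N
}.

(* [rootsR q] is the increasing list of the distinct real roots of q; it is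
   empty for q = 0, so root_{p,m} is undefined where p vanishes identically.
   [None] stands for "undefined". *)
Definition ir_eval (R : realType) (i : nat) (xi : iroot i) (r : 'rV[R]_i) :
    option R :=
  onth (polyrcf.rootsR (specialize (ir_poly xi) r)) (ir_index xi).-1.

(* Comparison of possibly undefined values; both sides have to be defined. *)
Definition pval_rel (T : Type) (P : T -> T -> Prop) (a b : option T) : Prop :=
  exists x y, [/\ a = Some x, b = Some y & P x y].

Definition pval_eq (T : Type) (a b : option T) : Prop :=
  pval_rel (fun x y => x = y) a b.

Definition pval_le d (T : porderType d) (a b : option T) : Prop :=
  pval_rel (fun x y => (x <= y)%O) a b.

Definition pval_lt d (T : porderType d) (a b : option T) : Prop :=
  pval_rel (fun x y => (x < y)%O) a b.

(* In [Sector l u], [l = None] means -oo and [u = None] means +oo. *)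
Inductive sinterval (i : nat) :=
| Section of iroot i
| Sector of option (iroot i) & option (iroot i).

Definition is_section (i : nat) (I : sinterval i) : bool :=
  if I is Section _ then true else false.

Definition lower (i : nat) (I : sinterval i) : option (iroot i) :=
  match I with Section b => Some b | Sector l _ => l end.

Definition upper (i : nat) (I : sinterval i) : option (iroot i) :=
  match I with Section b => Some b | Sector _ u => u end.

Definition lower_at (R : realType) (i : nat) (I : sinterval i)
    (r : 'rV[R]_i) : option (\bar R) :=
  if lower I is Some xi then omap (@EFin R) (ir_eval xi r) else Some -oo%E.

Definition upper_at (R : realType) (i : nat) (I : sinterval i)
    (r : 'rV[R]_i) : option (\bar R) :=
  if upper I is Some xi then omap (@EFin R) (ir_eval xi r) else Some +oo%E.

Definition defined_at (R : realType) (i : nat) (I : sinterval i)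
    (r : 'rV[R]_i) : Prop :=
  lower_at I r <> None /\ upper_at I r <> None.

Definition in_fiber (R : realType) (i : nat) (I : sinterval i)
    (r : 'rV[R]_i) (x : R) : Prop :=
  match I with
  | Section b => ir_eval b r = Some x
  | Sector _ _ => pval_lt (lower_at I r) (Some x%:E) /\
                  pval_lt (Some x%:E) (upper_at I r)
  end.

Definition described (R : realType) (i : nat) (I : sinterval i)
    (S : set 'rV[R]_i) : set 'rV[R]_i.+1 :=
  [set x | S (init_coords x) /\ in_fiber I (init_coords x) (x 0 ord_max)].

Definition repr_on (R : realType) (i : nat) (I : sinterval i) (s : 'rV[R]_i)
    (T : set 'rV[R]_i.+1) : Prop :=
  [/\ defined_at I s,
      forall r, (@init_coords R i @` T) r -> defined_at I r
    & T = described I (@init_coords R i @` T)].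

(* The set of intervals C covers the cylinder over D.  Demanding one single j
   with repr(I_j, s) on a superset of the whole of D' would be unsatisfiable
   as soon as C has two members and D is inhabited (take for D' the full
   cylinder over D, which lies in no proper symbolic interval), so the interval
   is chosen pointwise: D' is covered by sets T_0, ..., T_(k-1) such that
   repr(I_j, s) holds on T_j. *)
Definition cov (R : realType) (i k : nat) (C : k.-tuple (sinterval i))
    (s : 'rV[R]_i) (D : set 'rV[R]_i) : Prop :=
  forall D' : set 'rV[R]_i.+1, @init_coords R i @` D' = D ->
  exists T : 'I_k -> set 'rV[R]_i.+1,
    (forall j, repr_on (tnth C j) s (T j)) /\
    D' `<=` \bigcup_(j in [set: 'I_k]) T j.

(* A relation on the set Xi is a relation on the subtype of its elements. *)
Definition ir_rel (i : nat) (Xi : set (iroot i)) : Type := Xi -> Xi -> Prop.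

Definition ir_closure (i : nat) (Xi : set (iroot i)) (le : ir_rel Xi) :
    ir_rel Xi :=
  Relation_Operators.clos_refl_trans Xi le.

Definition ir_ordering (i : nat) (Xi : set (iroot i)) (le : ir_rel Xi) :
    Prop :=
  Relation_Definitions.order Xi (ir_closure le).

Definition matches (R : realType) (i : nat) (Xi : set (iroot i))
    (le : ir_rel Xi) (s : 'rV[R]_i) : Prop :=
  (forall xi : Xi, ir_eval (set_val xi) s <> None) /\
  (forall xi xi' : Xi, le xi xi' ->
     pval_le (ir_eval (set_val xi) s) (ir_eval (set_val xi') s)).

(* Over D the two roots exist and compare in the same way as at s. *)
Definition maintains (R : realType) (i : nat) (Xi : set (iroot i))
    (le : ir_rel Xi) (s : 'rV[R]_i) (D : set 'rV[R]_i) : Prop :=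
  forall xi xi' : Xi, le xi xi' -> forall r, D r ->
    [/\ ir_eval (set_val xi) r <> None,
        ir_eval (set_val xi') r <> None,
        pval_lt (ir_eval (set_val xi) r) (ir_eval (set_val xi') r) <->
          pval_lt (ir_eval (set_val xi) s) (ir_eval (set_val xi') s)
      & pval_eq (ir_eval (set_val xi) r) (ir_eval (set_val xi') r) <->
          pval_eq (ir_eval (set_val xi) s) (ir_eval (set_val xi') s)].

(* Partial sum of the power series with coefficients c over the multi-indices
   whose components are all smaller than n. *)
Definition psum (R : realType) (i : nat) (c : ('I_i -> nat) -> R)
    (h : 'rV[R]_i) (n : nat) : R :=
  \sum_(a : {ffun 'I_i -> 'I_n})
    c (fun j => a j : nat) * \prod_(j < i) h 0 j ^+ a j.

(* S need not be open: f is analytic on S if around every point of S it agrees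
   on S with the sum of an absolutely convergent power series, i.e. with an
   analytic function on a neighbourhood of that point in R^i. *)
Definition analytic_on (R : realType) (i : nat) (S : set 'rV[R]_i)
    (f : 'rV[R]_i -> R) : Prop :=
  forall x, S x -> exists (c : ('I_i -> nat) -> R) (rho : R),
    0 < rho /\
    forall h : 'rV[R]_i, (forall j, `|h 0 j| < rho) ->
      cvgn (psum (fun a => `|c a|) (\row_j `|h 0 j|)) /\
      (S (x + h) -> psum c h @ \oo --> f (x + h)).

Definition analytically_delineable (R : realType) (i : nat) (p : ratpoly i)
    (S : set 'rV[R]_i) : Prop :=
  (forall r, S r -> specialize p r != 0) /\
  exists (m : nat) (theta : 'I_m -> 'rV[R]_i -> R),
    [/\ forall j, analytic_on S (theta j),
        forall j j' : 'I_m, (j < j')%N ->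
          forall r, S r -> theta j r < theta j' r,
        forall r, S r -> forall x,
          root (specialize p r) x <-> exists j, x = theta j r
      & forall j r r', S r -> S r' ->
          mup (theta j r) (specialize p r) =
          mup (theta j r') (specialize p r')].

Definition delineable_over (R : realType) (i : nat) (p : ratpoly i)
    (D : set 'rV[R]_i) : Prop :=
  exists S : set 'rV[R]_i,
    [/\ connected S, D `<=` S & analytically_delineable p S].

(* Main.v *)
(** The fibre over a point [r] of [D] is swept from below: a point [x] lies in
the first interval whose upper bound it does not exceed.  This only needs
[I_(j+1).l(r) <= I_j.u(r)], with strict inequality between two sectors.  Both
hold at [s] and are transported to [r] along the chain of [ir_closure] relations.
The chain may be empty, and then it is delineability that makes the common bound
defined at [r]. *)
Require Import Defs.
From mathcomp Require Import all_boot all_order all_algebra.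
From mathcomp Require Import all_classical all_reals all_analysis.
Import Order.TTheory GRing.Theory Num.Theory.
Import numFieldNormedType.Exports.

Set Implicit Arguments.
Unset Strict Implicit.
Unset Printing Implicit Defensive.

Local Open Scope classical_set_scope.
Local Open Scope ring_scope.

Lemma onth_neq_None (T : Type) (t : seq T) (k : nat) :
  onth t k <> None <-> (k < size t)%N.
Proof.
by rewrite -onthTE; case: onth.
Qed.

(** Over a point of [D] the values of the [theta j] are pairwise distinct by their strict order and
    are exactly the roots, so they list [rootsR] up to permutation. *)
Lemma delineable_size_rootsR (R : realType) (i : nat) (p : ratpoly i)
    (D : set 'rV[R]_i) : delineable_over p D ->
  exists m, forall r, D r -> size (polyrcf.rootsR (specialize p r)) = m.
Proof.
move=> [S [_ DS [p_neq0 [m [theta [_ theta_lt rootE _]]]]]].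
exists m => r /DS Sr.
have theta_inj : injective (theta^~ r).
  move=> j j' /= e; apply/val_inj/eqP; rewrite eqn_leq; apply/andP.
  by split; rewrite leqNgt; apply/negP => /theta_lt/(_ r Sr); rewrite e ltxx.
rewrite -[RHS]card_ord cardE -(size_map (theta^~ r)).
apply/perm_size/uniq_perm; first exact: polyrcf.uniq_roots.
  by rewrite map_inj_uniq ?enum_uniq.
move=> x; rewrite -polyrcf.roots_on_rootsR ?p_neq0 //=; apply/idP/mapP.
  by move=> /rootE [//|j ->]; exists j; rewrite ?mem_enum.
by move=> [j _ ->]; apply/rootE => //; exists j.
Qed.

(** Whether the root of a given index exists depends only on the number of distinct real roots,
    which is constant over [D]. *)
Lemma delineable_ir_eval_defined (R : realType) (i : nat) (xi : iroot i)
    (D : set 'rV[R]_i) (r s : 'rV[R]_i) :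
  delineable_over (ir_poly xi) D -> D s -> D r ->
  ir_eval xi s <> None -> ir_eval xi r <> None.
Proof.
move=> /delineable_size_rootsR [m sz] Ds Dr.
by rewrite /ir_eval !onth_neq_None !sz.
Qed.

(** Induction on the closure. Definedness of [xi] at [r] is what the reflexive case rests on, since
    an empty chain gives no information at [r]; along a composite chain it passes to the middle
    root. *)
Lemma ir_closure_maintained (R : realType) (i : nat) (Xi : set (iroot i))
    (le : ir_rel Xi) (s : 'rV[R]_i) (D : set 'rV[R]_i) (r : 'rV[R]_i)
    (xi xi' : Xi) :
  matches le s -> maintains le s D -> D r -> ir_closure le xi xi' ->
  ir_eval (set_val xi) r <> None ->
  pval_le (ir_eval (set_val xi) r) (ir_eval (set_val xi') r) /\
  (pval_lt (ir_eval (set_val xi) s) (ir_eval (set_val xi') s) ->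
   pval_lt (ir_eval (set_val xi) r) (ir_eval (set_val xi') r)).
Proof.
move=> [defs les] maint Dr; elim=> {xi xi'}.
- move=> xi xi' lexi _.
  have [_ _ lt_iff eq_iff] := maint _ _ lexi _ Dr.
  split; last by move/lt_iff.
  have [a [b [ea eb]]] := les _ _ lexi.
  rewrite le_eqVlt => /orP[/eqP eab|lab].
    have /eq_iff[x [y [ex ey exy]]] :
      pval_eq (ir_eval (set_val xi) s) (ir_eval (set_val xi') s) by exists a, b.
    by exists x, y; split=> //; rewrite exy.
  have /lt_iff[x [y [ex ey /ltW exy]]] :
    pval_lt (ir_eval (set_val xi) s) (ir_eval (set_val xi') s) by exists a, b.
  by exists x, y.
- move=> xi; case: (ir_eval _ r) => // a _; split; first by exists a, a.
  by move=> [b [c [-> [->]]]]; rewrite ltxx.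
- move=> xi1 xi2 xi3 _ IH12 _ IH23 def1.
  have [[a [b [ea eb leab]]] lt12] := IH12 def1.
  have def2 : ir_eval (set_val xi2) r <> None by rewrite eb.
  have [[b' [c [eb' ec lebc]]] lt23] := IH23 def2.
  move: eb' lebc; rewrite eb => -[<-] lebc.
  split; first by exists a, c; split=> //; exact: le_trans lebc.
  move=> [x [z [ex ez ltxz]]].
  (* If the ends are strictly ordered at [s], one of the two halves is already strict there. That
     half stays strict at [r], and the other is weak at [r]. *)
  case ey: (ir_eval (set_val xi2) s) (defs xi2) => [y|//] _.
  case: (ltP x y) => [ltxy|leyx].
  + have [a' [b'' []]] : pval_lt (ir_eval (set_val xi1) r)
        (ir_eval (set_val xi2) r) by apply: lt12; exists x, y.
    rewrite ea eb => -[<-] [<-] ltab.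
    by exists a, c; split=> //; exact: lt_le_trans lebc.
  + have [b'' [c' []]] : pval_lt (ir_eval (set_val xi2) r)
        (ir_eval (set_val xi3) r).
      by apply: lt23; exists y, z; split=> //; exact: le_lt_trans ltxz.
    rewrite eb ec => -[<-] [<-] ltbc.
    by exists a, c; split=> //; exact: le_lt_trans ltbc.
Qed.

Lemma in_fiber_defined (R : realType) (i : nat) (I : sinterval i)
    (r : 'rV[R]_i) (x : R) : in_fiber I r x -> defined_at I r.
Proof.
case: I => [b|l u] /=; first by rewrite /defined_at /lower_at /upper_at /= => ->.
by move=> [[a [b [la _ _]]] [c [d [_ ub _]]]]; rewrite /defined_at la ub.
Qed.

(** The described set may project onto less than [D]. A point of it witnesses that the bounds are
    defined below it, and restricting [D] to the projection leaves the set unchanged. *)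
Lemma repr_on_described (R : realType) (i : nat) (I : sinterval i)
    (s : 'rV[R]_i) (D : set 'rV[R]_i) :
  defined_at I s -> repr_on I s (described I D).
Proof.
move=> defs; split=> //.
  by move=> _ [x [_ /in_fiber_defined defx] <-].
by apply/seteqP; split=> x [Dx fx]; split=> //; [exists x | case: Dx => y [] Dy _ <-].
Qed.

Lemma fiber_cover (R : realType) (i n : nat) (C : n.+1.-tuple (sinterval i))
    (r : 'rV[R]_i) :
  lower (tnth C ord0) = None -> upper (tnth C ord_max) = None ->
  (forall j j' : 'I_n.+1, j' = j.+1 :> nat -> exists a b : R,
     [/\ lower_at (tnth C j') r = Some a%:E, upper_at (tnth C j) r = Some b%:E,
         a <= b & is_section (tnth C j') || is_section (tnth C j) || (a < b)]) ->
  forall x, exists j, in_fiber (tnth C j) r x.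
Proof.
move=> low0 upn adj x.
(* A section contains its upper bound, a sector does not; hence weak against strict comparison. *)
pose below (I : sinterval i) :=
  if is_section I then pval_le (Some x%:E) (upper_at I r)
  else pval_lt (Some x%:E) (upper_at I r).
have below_max : `[< below (tnth C ord_max) >].
  apply/asboolP; move: upn; rewrite /below /upper_at.
  by case: (tnth C ord_max) => //= _ u ->; exists x%:E, +oo%E; rewrite ltry.
case: (@arg_minnP _ ord_max (fun j => `[< below (tnth C j) >]) val below_max).
move=> j /asboolP belowj minj; exists j.
have [j0|j_gt0] := posnP j.
  have {}j0 : j = ord0 by exact/val_inj.
  (* Having no lower bound, the first interval is a sector starting at [-oo]. *)
  subst j; move: low0 belowj; rewrite /below.
  case: (tnth C ord0) => //= _ u ->; split=> //.
  by exists -oo%E, x%:E; rewrite ltNyr.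
have jn : (j.-1 < n.+1)%N by apply: leq_ltn_trans (ltn_ord j); exact: leq_pred.
pose j1 := Ordinal jn.
have [a [b [ea eb leab strict]]] := adj j1 j (esym (prednK j_gt0)).
have : ~ below (tnth C j1).
  by move=> /asboolP/minj /=; rewrite leqNgt prednK // leqnn.
move: belowj strict; rewrite /below eb.
have -> : (if is_section (tnth C j1) then pval_le (Some x%:E) (Some b%:E)
  else pval_lt (Some x%:E) (Some b%:E)) <->
  (if is_section (tnth C j1) then x <= b else x < b).
  case: is_section; split.
  - by move=> [_ [_ [[<-] [<-]]]]; rewrite lee_fin.
  - by move=> xb; exists x%:E, b%:E; rewrite lee_fin.
  - by move=> [_ [_ [[<-] [<-]]]]; rewrite lte_fin.
  - by move=> xb; exists x%:E, b%:E; rewrite lte_fin.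
move: ea; case: (tnth C j) => [xi|l u] /= ea belowj strict nbelow.
  (* Section case: [x] is squeezed by [x <= a <= b <= x], where [a] is the value of the section. *)
  have lebx : b <= x.
    by move: nbelow; case: is_section => /negP; rewrite -?ltNge -?leNgt // => /ltW.
  move: ea belowj; rewrite /lower_at /upper_at /=.
  case: (ir_eval xi r) => //= a' [->] [_ [_ [[<-] [<-]]]].
  rewrite lee_fin => lexa; congr Some; apply/le_anti.
  by rewrite lexa (le_trans leab lebx).
split=> //; rewrite ea; exists a%:E, x%:E; split=> //; rewrite lte_fin.
(* Sector case, with [a < x] to show: after a section, [a <= b < x]; after a sector,
   [a < b <= x]. *)
move: strict nbelow; case: is_section => /= strict /negP.
  by rewrite -ltNge; exact: le_lt_trans.
by rewrite -leNgt; exact: lt_le_trans.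
Qed.

Theorem lemma8p4 (R : realType) (i : nat) (hi : (0 < i)%N)
    (D : set 'rV[R]_i) (s : 'rV[R]_i)
    (n : nat) (C : n.+1.-tuple (sinterval i))
    (Xi : set (iroot i)) (le : ir_rel Xi) (hle : ir_ordering le)
    (C1 : lower (tnth C ord0) = None /\ upper (tnth C ord_max) = None)
    (C2 : forall j j' : 'I_n.+1, j' = j.+1 :> nat ->
       pval_lt (lower_at (tnth C j) s) (lower_at (tnth C j') s) \/
       [/\ pval_eq (lower_at (tnth C j) s) (lower_at (tnth C j') s),
           is_section (tnth C j) & ~~ is_section (tnth C j')])
    (C3 : forall j j' : 'I_n.+1, j' = j.+1 :> nat ->
       pval_lt (upper_at (tnth C j) s) (upper_at (tnth C j') s) \/
       [/\ pval_eq (upper_at (tnth C j) s) (upper_at (tnth C j') s),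
           ~~ is_section (tnth C j) & is_section (tnth C j')])
    (C4 : forall j j' : 'I_n.+1, j' = j.+1 :> nat ->
       pval_lt (lower_at (tnth C j') s) (upper_at (tnth C j) s) \/
       pval_eq (lower_at (tnth C j') s) (upper_at (tnth C j) s) /\
       (is_section (tnth C j') || is_section (tnth C j)))
    (hmatch : matches le s)
    (hchain : forall j j' : 'I_n.+1, j' = j.+1 :> nat ->
       exists xi xi' : Xi,
         [/\ lower (tnth C j') = Some (set_val xi),
             upper (tnth C j) = Some (set_val xi')
           & ir_closure le xi xi'])
    (ha : D s)
    (hb : connected D)
    (hc : matches le s /\ maintains le s D)
    (hd : forall j j' : 'I_n.+1, j' = j.+1 :> nat ->
       (forall xi, upper (tnth C j) = Some xi ->
          delineable_over (ir_poly xi) D) /\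
       (forall xi, lower (tnth C j') = Some xi ->
          delineable_over (ir_poly xi) D)) :
  cov C s D.
Proof.
have [mat maint] := hc; have [low0 upn] := C1.
(* A comparison by [pval_rel] forces both sides to be defined, so [C2] with the predecessor handles
   lower bounds and [C3] with the successor handles upper bounds; the two extreme bounds are
   infinite. *)
have defs j : defined_at (tnth C j) s.
  split.
  - have [j0|j_gt0] := posnP j.
      have -> : j = ord0 by exact/val_inj.
      by rewrite /lower_at low0.
    have jn : (j.-1 < n.+1)%N.
      by apply: leq_ltn_trans (ltn_ord j); exact: leq_pred.
    by case: (C2 (Ordinal jn) j (esym (prednK j_gt0))) =>
      [[a [b [_ e _]]]|[[a [b [_ e _]]] _ _]]; rewrite e.
  - have [jn|jn] := ltnP j n.
      have jn1 : (j.+1 < n.+1)%N by [].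
      by case: (C3 j (Ordinal jn1) erefl) =>
        [[a [b [e _ _]]]|[[a [b [e _ _]]] _ _]]; rewrite e.
    have -> : j = ord_max.
      by apply/val_inj/eqP; rewrite eqn_leq jn -ltnS ltn_ord.
    by rewrite /upper_at upn.
have adj r : D r -> forall j j' : 'I_n.+1, j' = j.+1 :> nat -> exists a b : R,
    [/\ lower_at (tnth C j') r = Some a%:E, upper_at (tnth C j) r = Some b%:E,
     a <= b & is_section (tnth C j') || is_section (tnth C j) || (a < b)].
  move=> Dr j j' jj'; have [xi [xi' [exi exi' clos]]] := hchain j j' jj'.
  have [_ /(_ _ exi) del] := hd j j' jj'.
  (* Delineability carries the lower bound from [s] to [r]; the chain then yields the upper bound at
     [r]. *)
  have defr := delineable_ir_eval_defined del ha Dr (mat.1 xi).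
  have [[a [b [ea eb leab]]] ltr] := ir_closure_maintained mat maint Dr clos defr.
  exists a, b; split=> //.
  - by rewrite /lower_at exi ea.
  - by rewrite /upper_at exi' eb.
  (* Equality at [s] is allowed only next to a section; otherwise the inequality is strict at [s],
     hence at [r]. *)
  have [lts|[_ ->//]] := C4 j j' jj'.
  suff /ltr[a' [b' []]] :
      pval_lt (ir_eval (set_val xi) s) (ir_eval (set_val xi') s).
    by rewrite ea eb => -[<-] [<-] ->; rewrite orbT.
  move: lts; rewrite /lower_at /upper_at exi exi' => -[y [z []]].
  case: (ir_eval _ s) => //= c [<-]; case: (ir_eval _ s) => //= d [<-].
  by rewrite lte_fin => ltcd; exists c, d.
(* The same pieces of the cylinder over [D] serve every [D']. *)
move=> D' projD'; exists (fun j => described (tnth C j) D); split.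
  by move=> j; exact: repr_on_described.
move=> x D'x; have Dx : D (init_coords x) by rewrite -projD'; exists x.
by have [j fj] := fiber_cover low0 upn (adj _ Dx) (x 0 ord_max); exists j.
Qed.
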